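(* Let $X$ be a complex Hilbert space and let $T\colon X\to X$ be an invertible bounded linear operator. Then $T$ has the shadowing property if and only if $$\sigma_r(T)\cap\mathbb T=\emptyset,$$ where $\sigma_r(T)$ is the right spectrum of $T$ and $\mathbb T=\{\lambda\in\mathbb C : |\lambda|=1\}$ is the unit circle.
   Context: $L(X)$ denotes the space of bounded linear operators on $X$, with identity operator $I$. An operator $T\in L(X)$ is invertible if there exists $S\in L(X)$ with $ST=TS=I$, and right invertible if there exists $S\in L(X)$ with $TS=I$. The right spectrum of $T\in L(X)$ is $\sigma_r(T)=\{\lambda\in\mathbb C : \lambda I-T \text{ is not right invertible}\}$. For $\delta>0$, a $\delta$-pseudotrajectory of an invertible $T\in L(X)$ is a sequence $(x_n)_{n\in\mathbb Z}$ in $X$ such that $\|x_{n+1}-Tx_n\|\le\delta$ for all $n\in\mathbb Z$. The operator $T$ has the shadowing property if for every $\epsilon>0$ there exists $\delta>0$ such that for every $\delta$-pseudotrajectory $(x_n)_{n\in\mathbb Z}$ of $T$ there exists $x\in X$ with $\|x_n-T^nx\|\le\epsilon$ for all $n\in\mathbb Z$. *)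

(* Defs.v *)
From HB Require Import structures.
From mathcomp Require Import all_boot all_order all_algebra sesquilinear complex.
From mathcomp Require Import all_classical all_reals topology normedtype.

Set Implicit Arguments.
Unset Strict Implicit.
Unset Printing Implicit Defensive.

Import Order.TTheory GRing.Theory Num.Theory.
Import numFieldNormedType.Exports.

Local Open Scope classical_set_scope.
Local Open Scope ring_scope.
Local Open Scope complex_scope.

(* The norm of a normed module over R[i] takes values in R[i]; since z <= w in
   R[i] means that w - z is a nonnegative real, real bounds r : R enter
   inequalities through the embedding r%:C. *)

Section Operators.
Context {R : realType} {X : completeNormedModType R[i]}.

Definition bounded_operator (T : {linear X -> X}) : Prop :=
  exists M : R, forall x, `|T x| <= M%:C * `|x|.

Definition invertible_operator (T : {linear X -> X}) : Prop :=
  exists S : {linear X -> X},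
    [/\ bounded_operator S, S \o T =1 id & T \o S =1 id].

Definition right_invertible_operator (T : {linear X -> X}) : Prop :=
  exists S : {linear X -> X}, bounded_operator S /\ T \o S =1 id.

Definition right_spectrum (T : {linear X -> X}) : set R[i] :=
  [set l : R[i] | ~ right_invertible_operator (l \*: idfun \- T)].

(* For negative n, T^n is an iterate of the library's choice-based inverse
   function, which is the genuine inverse when T is invertible
   (see zpow_op_inverse). *)
Definition zpow_op (T : X -> X) (n : int) : X -> X :=
  match n with
  | Posz k => iter k T
  | Negz k => iter k.+1 (pinv [set: X] T)
  end.

Lemma zpow_op_inverse (T S : X -> X) (k : nat) :
  S \o T =1 id -> T \o S =1 id -> zpow_op T (- k%:Z) =1 iter k S.
Proof.
move=> ST TS x; have pinvT : pinv [set: X] T = S.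
  apply/funext => y; have Tinj : injective T := can_inj (g := S) ST.
  apply: Tinj; apply: (etrans _ (esym (TS y))).
  by apply: pinvK; rewrite inE; exists (S y) => //; exact: TS.
by case: k => [|k] //; rewrite -[- _]/(Negz k) /= pinvT.
Qed.

Definition pseudotrajectory (T : X -> X) (delta : R) (x : int -> X) : Prop :=
  forall n : int, `|x (n + 1) - T (x n)| <= delta%:C.

Definition shadowing_property (T : X -> X) : Prop :=
  forall eps : R, 0 < eps ->
    exists2 delta : R, 0 < delta &
      forall x : int -> X, pseudotrajectory T delta x ->
        exists y : X, forall n : int, `|x n - zpow_op T n y| <= eps%:C.

End Operators.

Definition unit_circle {R : realType} : set R[i] := [set l : R[i] | `|l| = 1].

(* Main.v *)
(** Write A(l) = l I - T.  Shadowing solves v_(n+1) - T v_n = l^n z with v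
    bounded; averaging l^(-n) v_n shows that A(l) a = z has approximate solutions
    of norm at most K |z|, and in a Hilbert space the solutions of minimal norm
    then exist and depend linearly on z, so A(l) has a bounded right inverse.

    Conversely, by compactness A(l) a = z is solvable with |a| <= C |z| uniformly
    on the unit circle.  The finite Fourier transform turns this into solutions
    of y_(n+1) - T y_n = z_n on windows of length N with |y_n| <= C sqrt(N) sup |z|.
    Gluing windows with a partition of unity of slope O(1/N) leaves a residual
    O(1/sqrt(N)), and for N large an iteration yields a bounded solution of
    y_(n+1) - T y_n = z_n on all integers for every bounded z.  Subtracting it
    from a pseudotrajectory leaves the orbit that shadows it. *)
From HB Require Import structures.
Require Import Defs.
From mathcomp Require Import all_boot all_order all_algebra sesquilinear complex.
From mathcomp Require Import all_classical all_reals topology normedtype.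
From mathcomp Require Import cyclic separable cyclotomic.
From mathcomp Require Import ring lra zify.

Set Implicit Arguments.
Unset Strict Implicit.
Unset Printing Implicit Defensive.

Import Order.TTheory GRing.Theory Num.Theory.
Import numFieldNormedType.Exports.

Local Open Scope classical_set_scope.
Local Open Scope ring_scope.

(** * Real-valued norm and completeness *)

Section RealNorm.
Local Open Scope complex_scope.
Context {R : realType}.

(** Norms live in [R[i]], which is only partially ordered; their real part lives in the totally
    ordered, complete field [R], where suprema and real arithmetic are available. *)
Definition rnorm (V : normedZmodType R[i]) (x : V) : R := complex.Re `|x|.

Section NormedZmod.
Context {V : normedZmodType R[i]}.
Implicit Types x y : V.

Lemma rnormE x : `|x| = (rnorm x)%:C.
Proof. by rewrite /rnorm RRe_real ?normr_real. Qed.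

Lemma rnorm_le x (r : R) : (`|x| <= r%:C) = (rnorm x <= r).
Proof. by rewrite rnormE lecR. Qed.

Lemma rnorm_ge0 x : 0 <= rnorm x.
Proof. by rewrite -ler0c -rnormE. Qed.

Lemma rnorm0 : rnorm (0 : V) = 0.
Proof. by rewrite /rnorm normr0. Qed.

Lemma rnorm_eq0 x : rnorm x = 0 -> x = 0.
Proof. by move=> x0; apply/normr0_eq0; rewrite rnormE x0. Qed.

Lemma rnormN x : rnorm (- x) = rnorm x.
Proof. by rewrite /rnorm normrN. Qed.

Lemma rnormC x y : rnorm (x - y) = rnorm (y - x).
Proof. by rewrite -opprB rnormN. Qed.

Lemma rnormD x y : rnorm (x + y) <= rnorm x + rnorm y.
Proof. by rewrite -lecR rmorphD /= -!rnormE ler_normD. Qed.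

Lemma rnormB x y : rnorm (x - y) <= rnorm x + rnorm y.
Proof. by rewrite -(rnormN y) rnormD. Qed.

Lemma rnorm_triangle y x z : rnorm (x - z) <= rnorm (x - y) + rnorm (y - z).
Proof. by rewrite (le_trans _ (rnormD _ _)) // addrA subrK. Qed.

Lemma rnorm_sum (n : nat) (F : nat -> V) (r : nat -> R) :
  (forall i, (i < n)%N -> rnorm (F i) <= r i) ->
  rnorm (\sum_(i < n) F i) <= \sum_(i < n) r i.
Proof.
elim: n => [|n IH] Fr; first by rewrite !big_ord0 rnorm0.
rewrite !big_ord_recr /= (le_trans (rnormD _ _)) // lerD ?Fr //.
by apply: IH => i /ltnW; apply: Fr.
Qed.

End NormedZmod.

Lemma rnormM (a b : R[i]) : rnorm (a * b) = rnorm a * rnorm b.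
Proof. by apply: complexI; rewrite rmorphM /= -!rnormE normrM. Qed.

Lemma rnorm_real (r : R) : rnorm r%:C = `|r|.
Proof.
by rewrite /rnorm normc_def /= expr0n addr0 sqrtr_sqr.
Qed.

Lemma rnormV (a : R[i]) : rnorm a^-1 = (rnorm a)^-1.
Proof. by apply: complexI; rewrite fmorphV /= -!rnormE normfV. Qed.

Lemma rnorm1 : rnorm (1 : R[i]) = 1.
Proof. by rewrite /rnorm normr1. Qed.

Lemma rnormX (a : R[i]) n : rnorm (a ^+ n) = rnorm a ^+ n.
Proof. by elim: n => [|n IH]; rewrite ?expr0 ?rnorm1 // !exprS rnormM IH. Qed.

Lemma rnormZ (V : normedModType R[i]) (a : R[i]) (x : V) :
  rnorm (a *: x) = rnorm a * rnorm x.
Proof. by apply: complexI; rewrite rmorphM /= -!rnormE normrZ. Qed.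

Lemma rnormZr (V : normedModType R[i]) (r : R) (x : V) :
  rnorm (r%:C *: x) = `|r| * rnorm x.
Proof. by rewrite rnormZ rnorm_real. Qed.

Lemma rnorm_complete (V : completeNormedModType R[i]) (u : nat -> V) :
  (forall e, 0 < e -> exists N, forall m n, (N <= m)%N -> (N <= n)%N ->
    rnorm (u m - u n) <= e) ->
  exists l, forall e, 0 < e -> exists N, forall n, (N <= n)%N ->
    rnorm (u n - l) <= e.
Proof.
move=> cu.
(* A positive element of [R[i]] is real, so balls of complex radius reduce to real radii. *)
have toR (e : R[i]) : 0 < e -> exists2 r : R, 0 < r & e = r%:C.
  move=> e0; exists (complex.Re e); last by rewrite RRe_real ?gtr0_real.
  by rewrite -ltcR RRe_real ?gtr0_real.
have : cauchy (u @ \oo).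
  apply: cauchy_exP => e /toR[r r0 ->{e}].
  have [|N uN] := cu (r / 2); first by rewrite divr_gt0.
  exists (u N), N => // n Nn; rewrite /= -ball_normE /ball_ /= rnormE ltcR.
  by rewrite (le_lt_trans (uN _ _ _ Nn)) // ltr_pdivrMr // ltr_pMr // ltr1n.
move=> /cauchy_cvgP /cvg_ex[l /cvg_ballP ul]; exists l => e e0.
have [|N _ uN] := ul e%:C; first by rewrite ltcR.
exists N => n /uN; rewrite /= -ball_normE /ball_ /= rnormE ltcR rnormC.
exact: ltW.
Qed.

End RealNorm.

(** * Successive approximation *)

Section Iteration.
Context {R : realType}.

Lemma ler_half_pow (c e : R) : 0 < e -> exists k, c / 2 ^+ k <= e.
Proof.
move=> e0; exists (Num.truncn `|c / e|).
rewrite ler_pdivrMr ?exprn_gt0 // -ler_pdivrMl // mulrC.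
rewrite (le_trans (ler_norm _)) // (le_trans (ltW (truncnS_gt _))) //.
by rewrite -natrX ler_nat ltn_expl.
Qed.

Lemma le0_half_pow (c x : R) : (forall k, x <= c / 2 ^+ k) -> x <= 0.
Proof.
move=> xc; apply/ler_addgt0Pr => e e0; rewrite add0r.
by have [k /(le_trans (xc k))] := ler_half_pow c e0.
Qed.

Context {X : completeNormedModType R[i]}.

(** Solving repeatedly for the residual halves it each time, so the corrections are dominated by a
    geometric series of sum [2 * M * s]. Completeness gives the limit pointwise in [I], with uniform
    estimates. It serves both the resolvent equation ([I] is [unit]) and the difference equation
    ([I] is [int]). *)
Lemma exact_of_half_approx (I : Type) (A : (I -> X) -> I -> X) (B M : R) :
  0 <= M ->
  (forall u v i, A (u \+ v) i = A u i + A v i) ->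
  (forall u s, (forall i, rnorm (u i) <= s) ->
    forall i, rnorm (A u i) <= B * s) ->
  (forall z (s : R), 0 < s -> (forall i, rnorm (z i) <= s) ->
    exists u, (forall i, rnorm (u i) <= M * s) /\
              (forall i, rnorm (z i - A u i) <= s / 2)) ->
  forall z (s : R), 0 < s -> (forall i, rnorm (z i) <= s) ->
    exists u, (forall i, rnorm (u i) <= 2 * M * s) /\ (forall i, A u i = z i).
Proof.
move=> M0 AD Abd approx z s s0 zs.
have A0 i : A (fun=> 0) i = 0.
  apply: rnorm_eq0; apply/eqP; rewrite eq_le rnorm_ge0 andbT -(mulr0 B).
  by apply: Abd => j; rewrite rnorm0.
have AB u v i : A (u \- v) i = A u i - A v i.
  apply/eqP; rewrite -subr_eq opprK -AD; apply/eqP; congr (A _ i).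
  by apply/funext => j /=; rewrite subrK.
(* Corrections are chosen for all pairs of a right-hand side and a scale, with default 0 where the
   bound fails, so that the recursion below carries no proofs. *)
have /choice[g gP] (p : (I -> X) * R) : exists u, 0 < p.2 ->
    (forall i, rnorm (p.1 i) <= p.2) ->
    (forall i, rnorm (u i) <= M * p.2) /\
    (forall i, rnorm (p.1 i - A u i) <= p.2 / 2).
  have [[p0 p1]|np] := pselect (0 < p.2 /\ forall i, rnorm (p.1 i) <= p.2).
    by have [u uP] := approx _ _ p0 p1; exists u.
  by exists (fun=> 0) => p0 p1; case: np.
(* [st k] pairs the current partial sum with the residual it leaves. *)
pose fix st k : (I -> X) * (I -> X) :=
  if k is j.+1 then
    let w := g ((st j).2, s / 2 ^+ j) in ((st j).1 \+ w, (st j).2 \- A w)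
  else (fun=> 0, z).
have sk0 k : 0 < s / 2 ^+ k by rewrite divr_gt0 // exprn_gt0.
have res k : forall i, rnorm ((st k).2 i) <= s / 2 ^+ k.
  elim: k => [|k IH] i /=; first by rewrite expr0 divr1.
  have [_ /(_ i)] := gP ((st k).2, s / 2 ^+ k) (sk0 k) IH.
  by rewrite /= exprS invfM mulrA mulrAC -mulrA mulrC.
have Ast k i : A (st k).1 i = z i - (st k).2 i.
  elim: k i => [|k IH] i /=; first by rewrite A0 subrr.
  by rewrite AD IH opprB addrA addrAC.
(* The factor [1 - 1 / 2 ^+ m] is the exact finite geometric sum; it makes the induction on [m]
   close. *)
have step k m i : rnorm ((st (k + m)%N).1 i - (st k).1 i) <=
    2 * M * (s / 2 ^+ k) * (1 - 1 / 2 ^+ m).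
  elim: m => [|m IH]; first by rewrite addn0 subrr rnorm0 expr0 divr1 subrr mulr0.
  rewrite addnS (le_trans (rnorm_triangle ((st (k + m)%N).1 i) _ _)) //.
  have [/(_ i) /= gM _] := gP ((st (k + m)%N).2, s / 2 ^+ (k + m)) (sk0 _) (res _).
  rewrite /= [_ + _ - _]addrC addKr (le_trans (lerD gM IH)) //.
  rewrite exprD exprS !invfM le_eqVlt; apply/orP; left; apply/eqP.
  by field; rewrite ?expf_neq0 ?pnatr_eq0.
have stM k m i : rnorm ((st (k + m)%N).1 i - (st k).1 i) <=
    2 * M * (s / 2 ^+ k).
  apply: (le_trans (step k m i)); rewrite ler_piMr //.
    exact: mulr_ge0 (mulr_ge0 _ M0) (ltW (sk0 k)).
  by rewrite gerBl divr_ge0 // exprn_ge0.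
have /choice[u uP] (i : I) : exists l, forall e, 0 < e ->
    exists N, forall n, (N <= n)%N -> rnorm ((st n).1 i - l) <= e.
  apply: rnorm_complete => e e0.
  have [N Ne] := ler_half_pow (2 * (2 * M * s)) e0.
  exists N => m n Nm Nn; apply: le_trans Ne.
  apply: (le_trans (rnorm_triangle ((st N).1 i) _ _)); rewrite [X in _ + X]rnormC.
  rewrite (_ : _ / _ = 2 * M * (s / 2 ^+ N) + 2 * M * (s / 2 ^+ N)); last by ring.
  by rewrite -(subnKC Nm) -(subnKC Nn) lerD.
have ulim k i : rnorm (u i - (st k).1 i) <= 2 * M * (s / 2 ^+ k).
  apply/ler_addgt0Pr => e /(uP i)[N uN].
  rewrite (le_trans (rnorm_triangle ((st (k + N)%N).1 i) _ _)) // addrC lerD //.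
  by rewrite rnormC uN // leq_addl.
exists u; split=> i.
  by have := ulim 0%N i; rewrite /= subr0 expr0 divr1.
apply/eqP; rewrite -subr_eq0; apply/eqP/rnorm_eq0/eqP.
(* The error [A u - z] splits into [A] of the tail and the [k]-th residual, both of order
   [1 / 2 ^+ k]. *)
rewrite eq_le rnorm_ge0 andbT; apply: (@le0_half_pow (B * (2 * M * s) + s)) => k.
apply: (le_trans (rnorm_triangle (A (st k).1 i) _ _)).
rewrite -AB Ast addrAC subrr add0r rnormN mulrDl lerD //.
rewrite -!mulrA; apply: Abd => j /=; rewrite !mulrA -mulrA; exact: ulim.
Qed.

End Iteration.

(** * Bounded right inverses from solutions of minimal norm *)

Section RightInverse.
Local Open Scope complex_scope.
Context {R : realType} {X : completeNormedModType R[i]}.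
Context (dot : {dot X for Num.conj}).

Lemma bounded_rnorm (A : {linear X -> X}) : bounded_operator A <->
  exists2 B : R, 0 <= B & forall x, rnorm (A x) <= B * rnorm x.
Proof.
split=> [[B AB]|[B _ AB]]; last first.
  by exists B => x; rewrite !rnormE -rmorphM lecR.
exists `|B| => // x; apply: (@le_trans _ _ (B * rnorm x)).
  by have := AB x; rewrite !rnormE -rmorphM lecR.
by rewrite ler_wpM2r ?rnorm_ge0 // ler_norm.
Qed.

Lemma parallelogram (norm_dot : forall x : X, `|x| ^+ 2 = dot x x) (x y : X) :
  rnorm (x + y) ^+ 2 + rnorm (x - y) ^+ 2 = 2 * rnorm x ^+ 2 + 2 * rnorm y ^+ 2.
Proof.
apply: complexI; rewrite !(rmorphD, rmorphM) /= -!expr2 -!rnormE !norm_dot.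
by rewrite hnormD hnormB rmorph1; ring.
Qed.

Context (norm_dot : forall x : X, `|x| ^+ 2 = dot x x).
Context (A : {linear X -> X}) (A_bounded : bounded_operator A) (K : R).
Context (approx : forall z (e : R), 0 < e ->
  exists2 a, rnorm a <= K * rnorm z & rnorm (A a - z) <= e).

(* The infimum [d] of the norms of exact solutions is obtained as the
   supremum, over [e], of the infimum of the norms of [e]-solutions; by the
   parallelogram law near-minimal [e]-solutions are Cauchy as [e] tends to 0. *)
Lemma min_norm_solution z : exists a,
  [/\ A a = z, rnorm a <= K * rnorm z & forall b, A b = z -> rnorm a <= rnorm b].
Proof.
pose E := [set r : R | exists2 e, 0 < e &
  forall a, rnorm (A a - z) <= e -> r <= rnorm a].
have E0 : E 0 by exists 1 => // a _; exact: rnorm_ge0.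
have EK : ubound E (K * rnorm z).
  by move=> r [e e0 er]; have [a aK /er/le_trans->] := approx z e0.
have supE : has_sup E by split; [exists 0 | exists (K * rnorm z)].
pose d := sup E.
have d0 : 0 <= d by apply: sup_upper_bound.
have dlow (h : R) : 0 < h ->
    exists2 e, 0 < e & forall a, rnorm (A a - z) <= e -> d - h <= rnorm a.
  move=> h0; have [r [e e0 er] dr] := sup_adherent h0 supE.
  by exists e => // a /er ra; rewrite (le_trans (ltW dr)).
have dup (h : R) : 0 < h ->
    exists2 a, rnorm (A a - z) <= h & rnorm a <= d + h.
  move=> h0; apply: contrapT => nex.
  have : E (d + h).
    exists h => // a az; rewrite leNgt; apply/negP => /ltW ad.
    by apply: nex; exists a.
  move=> /(sup_upper_bound supE).
  by rewrite -/d gerDl leNgt h0.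
have k0 (k : nat) : 0 < 1 / 2 ^+ k :> R by rewrite divr_gt0 // exprn_gt0.
have /choice[u uP] (k : nat) : exists a,
    rnorm (A a - z) <= 1 / 2 ^+ k /\ rnorm a <= d + 1 / 2 ^+ k.
  by have [a] := dup _ (k0 k); exists a.
have kmono (N n : nat) : (N <= n)%N -> 1 / 2 ^+ n <= 1 / 2 ^+ N :> R.
  by move=> Nn; rewrite ler_pM2l // lef_pV2 ?posrE ?exprn_gt0 // ler_eXn2l // ltr1n.
have [|a ua] := rnorm_complete (u := u).
  (* The parallelogram law will bound the squared distance by [4 (d + h)^2 - 4 (d^2 - 2 d h) = 16 d
     h + 4 h^2], which is at most [h (16 d + 4)] since [h <= 1]. *)
  move=> e e0; pose h := Num.min 1 (e ^+ 2 / (16 * d + 4)).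
  have h0 : 0 < h by rewrite lt_min ltr01 divr_gt0 ?exprn_gt0 //; lra.
  have [f f0 fP] := dlow h h0.
  have g0 : 0 < Num.min f h by rewrite lt_min f0.
  have [N] := ler_half_pow 1 g0; rewrite le_min => /andP[Nf Nh].
  exists N => m n Nm Nn.
  have [[um1 um2] [un1 un2]] := (uP m, uP n).
  (* The midpoint of two approximate solutions is again one, so its norm is almost at least [d]. *)
  have mid : d - h <= rnorm (2^-1%:C *: (u m + u n)).
    apply: fP; apply: le_trans Nf.
    rewrite linearZ linearD /=.
    have -> : 2^-1%:C *: (A (u m) + A (u n)) - z =
        2^-1%:C *: ((A (u m) - z) + (A (u n) - z)).
      rewrite addrACA -opprD [in RHS]scalerDr scalerN; congr (_ - _).
      rewrite -[in RHS](scale1r z) -scalerDl scalerA.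
      rewrite -[1 + 1]/(2%:R) fmorphV rmorph_nat mulVf ?scale1r //.
      by rewrite pnatr_eq0.
    rewrite rnormZr ger0_norm ?invr_ge0 // ler_pdivrMl // mulr_natl mulr2n.
    apply: (le_trans (rnormD _ _)).
    by rewrite lerD // (le_trans um1, le_trans un1) // kmono.
  have {}um2 : rnorm (u m) <= d + h.
    by rewrite (le_trans um2) // lerD2l (le_trans _ Nh) // kmono.
  have {}un2 : rnorm (u n) <= d + h.
    by rewrite (le_trans un2) // lerD2l (le_trans _ Nh) // kmono.
  rewrite rnormZr ger0_norm ?invr_ge0 // ler_pdivlMl // in mid.
  have := parallelogram norm_dot (u m) (u n).
  have := rnorm_ge0 (u m - u n); have := rnorm_ge0 (u m + u n).
  have := rnorm_ge0 (u m); have := rnorm_ge0 (u n).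
  move: mid um2 un2.
  move: (rnorm (u m + u n)) (rnorm (u m)) (rnorm (u n)) (rnorm (u m - u n)).
  move=> p q r s mid qd rd r0 q0 p0 s0 par.
  have q2 : q ^+ 2 <= (d + h) ^+ 2 by rewrite lerXn2r ?nnegrE // addr_ge0 // ltW.
  have r2 : r ^+ 2 <= (d + h) ^+ 2 by rewrite lerXn2r ?nnegrE // addr_ge0 // ltW.
  (* Dropping [h ^+ 2] from the square of [d - h] keeps the bound valid when [d < h], where the left
     side is nonpositive. *)
  have p2 : 4 * (d ^+ 2 - 2 * d * h) <= p ^+ 2.
    have [hd|dh] := leP h d.
      have : (2 * (d - h)) ^+ 2 <= p ^+ 2.
        by rewrite lerXn2r ?nnegrE // mulr_ge0 // subr_ge0.
      by have := sqr_ge0 h; nra.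
    by have := sqr_ge0 p; nra.
  have h1 : h <= 1 by rewrite ge_min lexx.
  have he : h * (16 * d + 4) <= e ^+ 2.
    by rewrite -ler_pdivlMr; [rewrite ge_min lexx orbT|lra].
  have h2 : h ^+ 2 <= h by rewrite expr2 ler_piMl // ltW.
  have s2 : s ^+ 2 <= e ^+ 2 by lra.
  by move: s2; rewrite ler_pXn2r ?nnegrE // ltW.
have [B B0 AB] := (bounded_rnorm A).1 A_bounded.
have Aa : A a = z.
  apply/eqP; rewrite -subr_eq0; apply/eqP/rnorm_eq0/eqP.
  rewrite eq_le rnorm_ge0 andbT; apply/ler_addgt0Pr => e e0; rewrite add0r.
  have B1 : 0 < B + 1 by lra.
  have [|N uN] := ua (e / (2 * (B + 1))); first by rewrite divr_gt0 // mulr_gt0.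
  have [M] := ler_half_pow 1 (divr_gt0 e0 (ltr0Sn _ 1)).
  move=> /(le_trans (kmono _ (maxn N M) (leq_maxr _ _))) Me.
  have {}uN := uN _ (leq_maxl N M).
  have [um _] := uP (maxn N M); move: (maxn N M) => n in um uN Me.
  apply: (le_trans (rnorm_triangle (A (u n)) _ _)).
  have : rnorm (A a - A (u n)) <= e / 2; last by lra.
  rewrite -linearB (le_trans (AB _)) //= rnormC.
  apply: (@le_trans _ _ (B * (e / (2 * (B + 1))))); first by rewrite ler_wpM2l.
  rewrite mulrA ler_pdivrMr ?mulr_gt0 // mulrA divfK ?pnatr_eq0 //.
  by rewrite mulrC ler_pM2l // lerDl.
have ad : rnorm a <= d.
  apply/ler_addgt0Pr => e e0.
  have [N uN] := ua (e / 2) (divr_gt0 e0 (ltr0Sn _ 1)).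
  have [M] := ler_half_pow 1 (divr_gt0 e0 (ltr0Sn _ 1)).
  move=> /(le_trans (kmono _ (maxn N M) (leq_maxr _ _))) Me.
  have {}uN := uN _ (leq_maxl N M).
  have [_ um] := uP (maxn N M); move: (maxn N M) => n in um uN Me.
  rewrite rnormC in uN; have := rnormD (a - u n) (u n); rewrite subrK; lra.
exists a; split=> //; first exact: le_trans ad (sup_le_ub (ex_intro _ _ E0) EK).
move=> b Ab; apply: (le_trans ad); apply: sup_le_ub; first by exists 0.
by move=> r [e e0]; apply; rewrite Ab subrr rnorm0 ltW.
Qed.

(** Subtracting from [a] its projection [t *: k] gives another solution, and by Pythagoras lowers
    the squared norm by [|t|^2 (dot k k)]; minimality forces [t = 0]. *)
Lemma min_norm_orthogonal a k : A k = 0 ->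
  (forall b, A b = A a -> rnorm a <= rnorm b) -> dot a k = 0.
Proof.
move=> Ak amin; apply/eqP; case: (eqVneq k 0) => [->|k0]; first by rewrite linear0r.
pose t := dot a k / dot k k.
have kk : dot k k != 0 by rewrite dnorm_eq0.
have orth : dot (a - t *: k) k = 0.
  by rewrite linearBl linearZl_LR /= /t divfK // subrr.
have : rnorm a <= rnorm (a - t *: k).
  by apply: amin; rewrite linearB linearZ /= Ak scaler0 subr0.
have pyth : dot a a = dot (a - t *: k) (a - t *: k) + `|t| ^+ 2 * dot k k.
  rewrite -dnormZ -[in LHS](subrK (t *: k) a) hnormDd //.
  by rewrite linearZr_LR /= orth mulr0.
rewrite -lecR -!rnormE -ler_sqr ?nnegrE // !norm_dot pyth.
rewrite gerDl => le0; have : `|t| ^+ 2 * dot k k == 0.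
  by rewrite eq_le le0 mulr_ge0 ?exprn_ge0 // dnorm_ge0.
rewrite mulf_eq0 (negPf kk) orbF expf_eq0 /= normr_eq0 mulf_eq0 invr_eq0.
by rewrite (negPf kk) orbF.
Qed.

(** Minimal solutions are orthogonal to the kernel of [A]. The defect of linearity of [s] lies in
    the kernel and is orthogonal to it, hence vanishes. *)
Lemma right_invertible_of_approx : right_invertible_operator A.
Proof.
have /choice[s sP] := min_norm_solution.
have s_orth z k : A k = 0 -> dot (s z) k = 0.
  by move=> Ak; have [Asz _ smin] := sP z; apply: min_norm_orthogonal; rewrite ?Asz.
have As z : A (s z) = z by have [] := sP z.
have s_linear : linear s.
  move=> c x y; apply/eqP; rewrite -subr_eq0 -(dnorm_eq0 dot).
  set v := s _ - _.
  have Av : A v = 0.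
    by rewrite /v linearB linearD linearZ /= !As subrr.
  rewrite {1}/v linearBl linearDl linearZl_LR /= !s_orth //.
  by rewrite mulr0 addr0 subr0.
pose S : {linear X -> X} := HB.pack s (GRing.isLinear.Build _ _ _ _ s s_linear).
exists S; split; last exact: As.
by exists K => x; rewrite !rnormE -rmorphM lecR; have [] := sP x.
Qed.

End RightInverse.

(** * From shadowing to right invertibility on the circle *)

Section ShadowingToSpectrum.
Local Open Scope complex_scope.
Context {R : realType} {X : completeNormedModType R[i]} (T : {linear X -> X}).

Lemma averaged_solution (l : R[i]) (z : X) (v : nat -> X) (c e : R) :
  rnorm l = 1 -> 0 < e -> (forall n, rnorm (v n) <= c) ->
  (forall n, v n.+1 - T (v n) = l ^+ n *: z) ->
  exists2 a, rnorm a <= c & rnorm (l *: a - T a - z) <= e.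
Proof.
move=> l1 e0 vc vT.
have l0 : l != 0.
  by apply: contra_eq_neq l1 => ->; rewrite rnorm0 eq_sym oner_eq0.
(* Undoing the rotation makes the forcing constant: [l *: w n.+1 - T (w n) = z]. *)
pose w n := l ^- n *: v n.
have wc n : rnorm (w n) <= c.
  by rewrite rnormZ rnormV rnormX l1 expr1n invr1 mul1r.
have wT n : l *: w n.+1 - T (w n) = z.
  rewrite /w [T _]linearZ /= scalerA exprS invfM mulrA divff // mul1r.
  by rewrite -scalerBr vT scalerA mulVf ?scale1r // expf_neq0.
pose W N := \sum_(n < N) w n.
(* The sum telescopes up to a boundary term of norm at most [2 * c], which averaging over [2 ^ k]
   terms makes small. *)
have WT N : l *: W N - T (W N) = z *+ N - l *: (w N - w 0%N).
  elim: N => [|N IH].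
    by rewrite /W big_ord0 [T _]linear0 scaler0 subrr mulr0n subrr scaler0 subrr.
  rewrite /W big_ord_recr /= -/(W N) [T _]linearD scalerDr opprD addrACA IH.
  have -> : T (w N) = l *: w N.+1 - z by rewrite -[X in _ - X](wT N) subKr.
  by rewrite mulrSr !scalerBr !opprB -!addrA; congr (_ + _); rewrite addKr addrCA.
have [k ck] := ler_half_pow (2 * c) e0.
pose r : R := (2 ^+ k)^-1.
have r0 : 0 < r by rewrite invr_gt0 exprn_gt0.
exists (r%:C *: W (2 ^ k)%N).
  rewrite rnormZr gtr0_norm // ler_pdivrMl ?exprn_gt0 //.
  apply: (le_trans (rnorm_sum (r := fun=> c) _)) => [i _|]; first exact: wc.
  by rewrite sumr_const card_ord -(mulr_natl c) natrX.
have -> : l *: (r%:C *: W (2 ^ k)%N) - T (r%:C *: W (2 ^ k)%N) - z =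
    - (r%:C *: (l *: (w (2 ^ k)%N - w 0%N))).
  rewrite [T _]linearZ /= scalerA [l * _]mulrC -scalerA -scalerBr WT scalerBr.
  rewrite -scaler_nat [r%:C *: (_ *: z)]scalerA (_ : r%:C * (2 ^ k)%:R = 1) ?scale1r.
    by rewrite addrAC subrr add0r.
  by rewrite natrX /r fmorphV rmorphXn rmorph_nat mulVf // expf_neq0 ?pnatr_eq0.
rewrite rnormN rnormZr gtr0_norm // rnormZ l1 mul1r mulrC.
apply: le_trans ck; rewrite ler_wpM2r ?(ltW r0) // (le_trans (rnormB _ _)) //.
by rewrite mulr_natl mulr2n lerD.
Qed.

(** The orbit driven by [u] from 0 at time 0, extended by 0 to negative times, is a
    pseudotrajectory; its difference from the shadowing orbit solves the same recurrence and is
    bounded. *)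
Lemma shadowing_forward (delta : R) (u : nat -> X) :
  0 < delta ->
  (forall x : int -> X, pseudotrajectory T delta x ->
    exists y : X, forall n : int, `|x n - zpow_op T n y| <= 1%:C) ->
  (forall n, rnorm (u n) <= delta) ->
  exists2 v : nat -> X, forall n, rnorm (v n) <= 1 &
    forall n, v n.+1 - T (v n) = u n.
Proof.
move=> delta0 shadow u_le.
pose fix x (n : nat) : X := if n is k.+1 then T (x k) + u k else 0.
have [|y yP] := shadow (fun n => if n is Posz k then x k else 0).
  case=> [n|[|n]].
  - have -> : Posz n + 1 = n.+1%:Z by rewrite -addn1 PoszD.
    by rewrite rnorm_le /= [T _ + _]addrC addrK.
  - by rewrite rnorm_le linear0 subrr rnorm0 ltW.
  - have -> : Negz n.+1 + 1 = Negz n by rewrite !NegzE -[n.+2]addn1 PoszD opprD addrNK.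
    by rewrite rnorm_le linear0 subrr rnorm0 ltW.
exists (fun n => x n - iter n T y) => n; first by rewrite -rnorm_le (yP n%:Z).
by rewrite /= linearB opprB addrA addrNK [T _ + _]addrC addrK.
Qed.

Lemma right_invertible_of_shadowing (dot : {dot X for Num.conj})
    (norm_dot : forall x : X, `|x| ^+ 2 = dot x x) (l : R[i]) :
  bounded_operator T -> shadowing_property T -> `|l| = 1 ->
  right_invertible_operator (l \*: idfun \- T).
Proof.
move=> /bounded_rnorm[B B0 TB] shT; rewrite rnormE => /complexI l1.
have [delta delta0 shadow] := shT 1 ltr01.
apply: (@right_invertible_of_approx _ _ dot norm_dot _ _ delta^-1).
  apply/bounded_rnorm; exists (1 + B); first by rewrite addr_ge0.
  by move=> x; rewrite /= (le_trans (rnormB _ _)) // mulrDl lerD // rnormZ l1.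
move=> z e e0; have [->|z0] := eqVneq z 0.
  exists 0; first by rewrite !rnorm0 mulr0.
  by rewrite subr0 /= scaler0 linear0 subrr rnorm0 ltW.
have rz0 : 0 < rnorm z.
  by rewrite lt_neqAle rnorm_ge0 andbT eq_sym; apply: contraNneq z0 => /rnorm_eq0 ->.
(* Scaling by [c] makes the forcing have norm exactly [delta]; undoing it turns the bound 1 into
   [delta^-1 * rnorm z]. *)
pose c := delta / rnorm z.
have c0 : 0 < c by rewrite divr_gt0.
have [n|v v1 vT] := @shadowing_forward delta (fun n => l ^+ n *: (c%:C *: z))
  delta0 shadow.
  by rewrite rnormZ rnormX l1 expr1n mul1r rnormZr gtr0_norm // divfK // gt_eqF.
have [a a1 aP] := averaged_solution l1 (mulr_gt0 c0 e0) v1 vT.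
have ci : 0 < c^-1 by rewrite invr_gt0.
exists (c^-1%:C *: a).
  by rewrite rnormZr gtr0_norm // /c invf_div [leRHS]mulrC ler_piMr // divr_ge0 // ltW.
have -> : (l \*: idfun \- T) (c^-1%:C *: a) - z =
    c^-1%:C *: (l *: a - T a - c%:C *: z).
  rewrite /= [T _]linearZ !scalerBr /= !scalerA [_ * l]mulrC.
  by rewrite -rmorphM mulVf ?scale1r // gt_eqF.
by rewrite rnormZr gtr0_norm // ler_pdivrMl.
Qed.

End ShadowingToSpectrum.

(** * Uniform solvability on the unit circle *)

Section CircleResolvent.
Local Open Scope complex_scope.
Context {R : realType}.

Lemma rnorm_complex_le (z : R[i]) :
  rnorm z <= `|complex.Re z| + `|complex.Im z|.
Proof.
rewrite {1}[z]complexE (le_trans (rnormD _ _)) // rnormM !rnorm_real.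
by rewrite /rnorm normc_def /= expr0n add0r expr1n sqrtr1 mul1r.
Qed.

Context {X : completeNormedModType R[i]} (T : {linear X -> X}).

(** A right inverse [S] at [l], used at a nearby [q], leaves the residual [(l - q) *: S z], at most
    half of [z] in norm when [q] is close to [l]. Compactness then makes the bound on [S]
    uniform. *)
Lemma uniform_half_resolvent :
  (forall l : R[i], `|l| = 1 -> right_invertible_operator (l \*: idfun \- T)) ->
  exists2 M : R, 0 <= M & forall (l : R[i]) z, rnorm l = 1 -> exists2 a,
    rnorm a <= M * rnorm z & rnorm (z - (l *: a - T a)) <= rnorm z / 2.
Proof.
move=> rinv.
(* [P] is vacuous off the circle, so compactness of a square containing it suffices; the
   near-covering form, with [M] tending to infinity, yields one [M] for all points. *)
pose P (M : R) (p : R * R) := forall z, rnorm (p.1 +i* p.2) = 1 -> exists2 a,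
  rnorm a <= M * rnorm z & rnorm (z - ((p.1 +i* p.2) *: a - T a)) <= rnorm z / 2.
have Kc : compact (`[-1, 1]%classic `*` `[-1, 1]%classic : set (R * R)).
  by apply: compact_setX; exact: segment_compact.
have ball_rnorm (p q : R * R) (h : R) : ball p h q ->
    rnorm ((q.1 +i* q.2) - (p.1 +i* p.2)) <= 2 * h.
  move=> [/= p1 p2]; apply: (le_trans (rnorm_complex_le _)).
  rewrite /= mulr_natl mulr2n; apply: lerD.
    by move: p1; rewrite -ball_normE /ball_ /= distrC => /ltW.
  by move: p2; rewrite -ball_normE /ball_ /= distrC => /ltW.
have [|M [_ MP]] := (compact_near_coveringP _).1 Kc R (+oo)%R P _.
  move=> [a b] _; set l := a +i* b.
  have [l1|l1] := eqVneq (rnorm l) 1; last first.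
    (* The ball is that of the sup norm, so [q] stays within [2 * h], half the gap to the circle. *)
    pose h := `|rnorm l - 1| / 4.
    have h0 : 0 < h by rewrite divr_gt0 // normr_gt0 subr_eq0.
    exists (ball (a, b) h, setT); first by split; [exact: nbhsx_ballx|exact: filterT].
    move=> [q M] [/= /ball_rnorm ql _] z q1; exfalso.
    have := rnorm_triangle (q.1 +i* q.2) l 0; have := rnorm_triangle l (q.1 +i* q.2) 0.
    rewrite !subr0 q1 [rnorm (l - _)]rnormC; move: ql; rewrite /h /= -/l.
    move: h0; rewrite /h; move: (rnorm _) (rnorm _) => x y.
    by case: (ler0P (x - 1)); case: (ler0P (y - 1)); lra.
  have [|S [/bounded_rnorm[B B0 SB] lS]] := rinv l; first by rewrite rnormE l1.
  (* Chosen so that [2 * h * B <= 1 / 2]. *)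
  pose h := (4 * (B + 1))^-1.
  have h0 : 0 < h by rewrite invr_gt0 mulr_gt0 // ltr_wpDl.
  exists (ball (a, b) h, [set M | B < M]).
    by split; [exact: nbhsx_ballx|exact: (nbhs_pinfty_gt (num_real B))].
  move=> [q M] [/= /ball_rnorm ql BM] z q1; exists (S z).
    by rewrite (le_trans (SB _)) // ler_wpM2r ?rnorm_ge0 // ltW.
  have -> : z - ((q.1 +i* q.2) *: S z - T (S z)) = - (((q.1 +i* q.2) - l) *: S z).
    by rewrite -{1}(lS z) /= scalerBl opprB addrA addrNK opprB.
  rewrite rnormN rnormZ; apply: (@le_trans _ _ (2 * h * (B * rnorm z))).
    by rewrite ler_pM ?rnorm_ge0.
  rewrite mulrA mulrC ler_wpM2l ?rnorm_ge0 // /h invfM.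
  rewrite (_ : 2 * (4^-1 * (B + 1)^-1) * B = 2^-1 * (B / (B + 1))); last first.
    by field; rewrite ?pnatr_eq0 // gt_eqF // ltr_wpDl.
  by rewrite ler_piMr ?invr_ge0 // ler_pdivrMr ?ltr_wpDl // mul1r lerDl.
exists (Num.max 0 M + 1); first by rewrite addr_ge0 // le_max lexx.
move=> [a b] z l1; apply: (MP (Num.max 0 M + 1) _ (a, b)) => //=.
  by rewrite (@le_lt_trans _ _ (Num.max 0 M)) ?ltrDl // le_max lexx orbT.
have ab : a ^+ 2 + b ^+ 2 = 1.
  by apply: complexI; have := add_Re2_Im2 (a +i* b); rewrite rnormE l1 /= expr1n.
have := sqr_ge0 a; have := sqr_ge0 b.
by split; rewrite /= in_itv /=; apply/andP; split; nra.
Qed.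

Lemma uniform_resolvent :
  bounded_operator T ->
  (forall l : R[i], `|l| = 1 -> right_invertible_operator (l \*: idfun \- T)) ->
  exists2 C : R, 0 <= C & forall (l : R[i]) z, rnorm l = 1 -> exists2 a,
    rnorm a <= C * rnorm z & l *: a - T a = z.
Proof.
move=> /bounded_rnorm[B B0 TB] /uniform_half_resolvent[M M0 MP].
exists (2 * M) => [|l z l1]; first by rewrite mulr_ge0.
(* The iteration needs a positive scale, here [rnorm z], so [z = 0] is treated apart. *)
have [->|z0] := eqVneq z 0.
  by exists 0; rewrite ?rnorm0 ?mulr0 // scaler0 linear0 subrr.
have rz0 : 0 < rnorm z.
  by rewrite lt_neqAle rnorm_ge0 andbT eq_sym; apply: contraNneq z0 => /rnorm_eq0 ->.
have [||||u [uM uz]] := @exact_of_half_approx _ _ unit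
  (fun u i => l *: u i - T (u i)) (1 + B) M M0 _ _ _ (fun=> z) _ rz0.
- by move=> u v i /=; rewrite [T _]linearD scalerDr opprD addrACA.
- move=> u s us i; rewrite (le_trans (rnormB _ _)) // mulrDl lerD //.
    by rewrite rnormZ l1 !mul1r.
  by rewrite (le_trans (TB _)) // ler_wpM2l.
- move=> w s s0 ws; have [a aM az] := MP l (w tt) l1.
  exists (fun=> a); split=> [_|[]]; first by rewrite (le_trans aM) // ler_wpM2l.
  by rewrite (le_trans az) // ler_wpM2r ?invr_ge0.
- by [].
by exists (u tt).
Qed.

End CircleResolvent.

(** * Finite Fourier transform of vector sequences *)

Section FiniteFourier.
Local Open Scope complex_scope.
Context {R : realType}.

(** The polynomial [X^n - 1] splits and is separable, so it has [n] distinct roots, and these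
    include a primitive one. *)
Lemma complex_prim_root (n : nat) : (0 < n)%N -> exists w : R[i], n.-primitive_root w.
Proof.
move=> n0; have [r Dp] := closed_field_poly_normal ('X^n - 1 : {poly R[i]}).
rewrite (monicP _) ?monicXnsubC // scale1r in Dp.
have rn1 : all n.-unity_root r by apply/allP => w; rewrite -root_prod_XsubC -Dp.
have sz_r : (n <= size r)%N by rewrite -ltnS -(size_prod_XsubC r id) -Dp size_XnsubC.
have [|w] := hasP (has_prim_root n0 rn1 _ sz_r); last by exists w.
by rewrite -separable_prod_XsubC -Dp separable_Xn_sub_1 // pnatr_eq0 -lt0n.
Qed.

Lemma rnorm_prim_root (n : nat) (w : R[i]) : n.-primitive_root w -> rnorm w = 1.
Proof.
move=> wP; apply/eqP; rewrite -(pexpr_eq1 (prim_order_gt0 wP)) ?rnorm_ge0 //.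
by rewrite -rnormX (prim_expr_order wP) rnorm1.
Qed.

Lemma conj_invX (w : R[i]) (j : nat) : rnorm w = 1 -> Num.conj (w ^- j) = w ^+ j.
Proof.
move=> w1; rewrite invC_norm rnormE rnormX w1 expr1n rmorph1 expr1n invr1 mul1r.
exact: conjCK.
Qed.

Lemma sum_prim_root (n : nat) (w : R[i]) (i p : nat) : n.-primitive_root w ->
  (i < n)%N -> (p < n)%N ->
  \sum_(j < n) (w ^+ j) ^+ i * (w ^+ j) ^- p = (n * (i == p))%:R.
Proof.
move=> wP iN pN.
have w0 k : w ^+ k != 0.
  by rewrite expf_neq0 // (prim_root_eq0 wP) -lt0n (prim_order_gt0 wP).
pose x := w ^+ i / w ^+ p.
transitivity (\sum_(j < n) x ^+ j).
  apply: eq_bigr => j _; rewrite expr_div_n -!exprM.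
  by rewrite mulnC [(j * p)%N]mulnC.
have [pi|ip] := eqVneq i p.
  rewrite muln1 /x pi divff //; under eq_bigr do rewrite expr1n.
  by rewrite sumr_const card_ord.
have x1 : x - 1 != 0.
  rewrite subr_eq0 /x; apply: contra ip => /eqP xe.
  have : w ^+ i == w ^+ p by rewrite -(divfK (w0 p) (w ^+ i)) xe mul1r.
  by rewrite (eq_prim_root_expr wP) !modn_small.
apply: (mulfI x1); rewrite -subrX1 /x expr_div_n -!exprM.
rewrite mulnC exprM [(p * n)%N]mulnC exprM (prim_expr_order wP).
by rewrite !expr1n divr1 subrr muln0 mulr0.
Qed.

Context {X : completeNormedModType R[i]} (dot : {dot X for Num.conj}).
Context (norm_dot : forall x : X, `|x| ^+ 2 = dot x x).

(** The factor [1 / n] sits on the forward transform, so inversion carries none and Parseval reads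
    as an average. *)
Definition dft (n : nat) (w : R[i]) (z : nat -> X) (j : nat) : X :=
  n%:R^-1 *: \sum_(p < n) (w ^+ j) ^- p *: z p.

Lemma dft_inversion (n : nat) (w : R[i]) (z : nat -> X) (i : nat) :
  n.-primitive_root w -> (i < n)%N ->
  \sum_(j < n) (w ^+ j) ^+ i *: dft n w z j = z i.
Proof.
move=> wP iN; have n0 : n%:R != 0 :> R[i] by rewrite pnatr_eq0 -lt0n (prim_order_gt0 wP).
rewrite /dft; under eq_bigr do rewrite scalerA mulrC -scalerA scaler_sumr.
rewrite -scaler_sumr exchange_big /=.
under eq_bigr => p _.
  under eq_bigr => j _ do rewrite scalerA.
  rewrite -scaler_suml sum_prim_root //; over.
rewrite (bigD1 (Ordinal iN)) //= eqxx muln1 big1 ?addr0.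
  by rewrite scalerA mulVf // scale1r.
move=> p; rewrite -val_eqE /= => pi.
by rewrite eq_sym (negPf pi) muln0 scale0r.
Qed.

(** Expanding one argument of each inner product and exchanging the sums lets the inversion formula
    rebuild [z p] in the other argument. *)
Lemma dft_parseval (n : nat) (w : R[i]) (z : nat -> X) :
  n.-primitive_root w ->
  \sum_(j < n) rnorm (dft n w z j) ^+ 2 = n%:R^-1 * \sum_(p < n) rnorm (z p) ^+ 2.
Proof.
move=> wP; apply: complexI.
have w1 := rnorm_prim_root wP.
have sq (x : X) : (rnorm x ^+ 2)%:C = dot x x by rewrite rmorphXn /= -rnormE norm_dot.
rewrite rmorphM fmorphV rmorph_nat !rmorph_sum /=.
transitivity (n%:R^-1 * \sum_(p < n) \sum_(j < n)
    (w ^+ j) ^- p * dot (z p) (dft n w z j)).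
  rewrite exchange_big mulr_sumr; apply: eq_bigr => j _ /=.
  rewrite sq {1}/dft linearZl_LR linear_sumlz; congr (_ * _) => /=.
  by apply: eq_bigr => p _; rewrite linearZl_LR.
congr (_ * _); apply: eq_bigr => p _; rewrite sq.
have := dft_inversion z wP (ltn_ord p); move: (dft n w z) => d inv.
rewrite -[X in _ = dot _ X]inv linear_sumr.
apply: eq_bigr => j _; rewrite linearZr_LR /=; congr (_ * _).
by rewrite -[in RHS](@conj_invX (w ^+ j)) ?rnormX ?w1 ?expr1n //; exact/esym/conjCK.
Qed.

End FiniteFourier.

(** * Solutions on windows and their gluing *)

Section LocalSolutions.
Local Open Scope complex_scope.
Context {R : realType}.

(** Cauchy-Schwarz for [k ^ 2] terms: sum [2 t b_j <= t^2 + b_j^2] with [t = s / k], so that the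
    [t^2] add up to [s^2]. A square length avoids square roots. *)
Lemma sum_le_sqrt (k : nat) (b : nat -> R) (s : R) : (0 < k)%N -> 0 < s ->
  \sum_(j < k ^ 2) b j ^+ 2 <= s ^+ 2 -> \sum_(j < k ^ 2) b j <= k%:R * s.
Proof.
move=> k0 s0 bs; have kR : 0 < k%:R :> R by rewrite ltr0n.
pose t := s / k%:R; have t0 : 0 < t by rewrite divr_gt0.
rewrite -(ler_pM2l t0).
have : \sum_(j < k ^ 2) 2 * (t * b j) <= \sum_(j < k ^ 2) (t ^+ 2 + b j ^+ 2).
  by apply: ler_sum => j _; have := sqr_ge0 (t - b j); nra.
rewrite -!mulr_sumr big_split /= sumr_const card_ord -[t ^+ 2 *+ _]mulr_natl natrX.
rewrite -exprMn mulrC [X in X * 2]mulr_sumr -mulr_sumr.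
have -> : k%:R * t = s by rewrite /t mulrC divfK // gt_eqF.
have -> : t * (k%:R * s) = s ^+ 2 by rewrite /t mulrA divfK ?gt_eqF.
lra.
Qed.

(** Here [a] and [b] are the next values of two exact solutions, so [a - z] and [b - z] are their
    images under [T]; only the increment [h] of the weight leaves an error. *)
Lemma interpolation_residual (K : nzRingType) (V : lmodType K) (p h : K) (a b z : V) :
  z - ((1 - (p + h)) *: a + (p + h) *: b - ((1 - p) *: (a - z) + p *: (b - z))) =
  h *: (a - b).
Proof.
have -> : (1 - (p + h)) *: a + (p + h) *: b =
    ((1 - p) *: a + p *: b) - h *: (a - b).
  rewrite opprD addrA; move: (1 - p) => q.
  rewrite scalerBl scalerDl scalerBr opprB addrACA; congr (_ + _).
  exact: addrC.
have -> : (1 - p) *: (a - z) + p *: (b - z) = ((1 - p) *: a + p *: b) - z.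
  by rewrite !(scalerBr _ _ z) addrACA -opprD -scalerDl subrK scale1r.
by rewrite !opprB [_ - z + _]addrC subrKA addrC subrK.
Qed.

Context {X : completeNormedModType R[i]} (dot : {dot X for Num.conj}).
Context (norm_dot : forall x : X, `|x| ^+ 2 = dot x x).
Context (T : {linear X -> X}) (C : R) (C_ge0 : 0 <= C).
Context (resolvent : forall (l : R[i]) z, rnorm l = 1 -> exists2 a,
  rnorm a <= C * rnorm z & l *: a - T a = z).

(* Solving on the cyclic group of order [k ^ 2] by Fourier transform: Parseval
   and Cauchy-Schwarz bound the solution by the square root of the length. *)
Lemma finite_solution (k : nat) (z : nat -> X) (s : R) :
  (0 < k)%N -> 0 < s -> (forall i, rnorm (z i) <= s) ->
  exists2 y : nat -> X, forall i, rnorm (y i) <= C * k%:R * s &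
    forall i, (i < k ^ 2)%N -> y i.+1 - T (y i) = z i.
Proof.
move=> k0 s0 zs; have N0 : (0 < k ^ 2)%N by rewrite expn_gt0 k0.
have [w wP] := complex_prim_root (R := R) N0.
have w1 j : rnorm (w ^+ j) = 1 by rewrite rnormX (rnorm_prim_root wP) expr1n.
have /choice[a aP] (j : nat) : exists a,
    rnorm a <= C * rnorm (dft (k ^ 2) w z j) /\
    w ^+ j *: a - T a = dft (k ^ 2) w z j.
  by have [a] := resolvent (dft (k ^ 2) w z j) (w1 j); exists a.
exists (fun i => \sum_(j < k ^ 2) (w ^+ j) ^+ i *: a j) => i.
  apply: (@le_trans _ _ (\sum_(j < k ^ 2) C * rnorm (dft (k ^ 2) w z j))).
    apply: (@rnorm_sum _ _ _ (fun j => (w ^+ j) ^+ i *: a j)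
      (fun j => C * rnorm (dft (k ^ 2) w z j))) => j _.
    by rewrite rnormZ rnormX w1 expr1n mul1r; have [] := aP j.
  rewrite -mulr_sumr -mulrA ler_wpM2l //.
  apply: (@sum_le_sqrt k (fun j => rnorm (dft (k ^ 2) w z j))) => //.
  rewrite (dft_parseval norm_dot) // mulrC ler_pdivrMr ?ltr0n // mulrC.
  apply: (@le_trans _ _ (\sum_(p < k ^ 2) s ^+ 2)).
    by apply: ler_sum => p _; rewrite lerXn2r ?nnegrE ?rnorm_ge0 ?(ltW s0) ?zs.
  by rewrite sumr_const card_ord mulr_natl.
move=> iN; rewrite linear_sum -sumrB -[RHS](dft_inversion z wP iN).
apply: eq_bigr => j _; have [_ <-] := aP j.
by rewrite linearZ /= exprSr -scalerA -scalerBr.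
Qed.

(* Local solutions on windows of length [2 * L] overlapping by half are glued by
   a piecewise linear partition of unity, whose slope [1 / L] beats the growth
   of the local solutions in the square root of [L]. *)
Lemma global_half_solution : exists2 M : R, 0 <= M &
  forall (z : int -> X) (s : R), 0 < s -> (forall n, rnorm (z n) <= s) ->
  exists u : int -> X, (forall n, rnorm (u n) <= M * s) /\
    (forall n, rnorm (z n - (u (n + 1) - T (u n))) <= s / 2).
Proof.
(* The residual will be at most [2 * M * s / L = 2 * C * s / k], which [4 * C <= k] makes at most
   [s / 2]. *)
pose k := (Num.truncn (4 * C)).+1.
have kC : 4 * C <= k%:R by apply/ltW/truncnS_gt.
have kR : 0 < k%:R :> R by rewrite ltr0n.
pose L := (2 * k ^ 2)%N.
have L0 : (0 < L)%N by rewrite muln_gt0 expn_gt0.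
have LR : 0 < L%:R :> R by rewrite ltr0n.
(* The window length must be a perfect square for [finite_solution]. *)
have L2 : (L + L = (2 * k) ^ 2)%N by rewrite /L expnMn; lia.
pose M := C * (2 * k)%:R.
have M0 : 0 <= M by rewrite mulr_ge0.
exists M => // z s s0 zs.
have /choice[Y YP] (j : int) : exists y : nat -> X,
    (forall i, rnorm (y i) <= M * s) /\
    (forall i, (i < L + L)%N -> y i.+1 - T (y i) = z (j * L%:Z + i%:Z)).
  have [||y yM yz] := @finite_solution (2 * k) (fun i => z (j * L%:Z + i%:Z)) s _ s0.
  - by rewrite muln_gt0.
  - by move=> i; apply: zs.
  by exists y; split=> // i; rewrite L2; apply: yz.
(* On block [j], the second half of window [j - 1] fades out while the first half of window [j]
   fades in. *)
pose F (j : int) (i : nat) : X :=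
  (1 - i%:R / L%:R : R)%:C *: Y (j - 1) (L + i)%N + (i%:R / L%:R : R)%:C *: Y j i.
have FL j : F j L = F (j + 1) 0%N.
  rewrite /F addrK addn0 divff ?gt_eqF // subrr mul0r subr0.
  by rewrite !scale0r scale1r add0r addr0.
pose u n : X := F (n %/ L%:Z)%Z `|(n %% L%:Z)%Z|%N.
(* The endpoint [i = L] is included so that the step from [n] to [n + 1] may cross into the next
   block. *)
have uF (j : int) (i : nat) : (i <= L)%N -> u (j * L%:Z + i%:Z) = F j i.
  rewrite leq_eqVlt => /orP[/eqP->|iL].
    rewrite FL /u (_ : j * L%:Z + L%:Z = (j + 1) * L%:Z); last by rewrite mulrDl mul1r.
    by rewrite mulzK ?modzMl // -lt0n.
  by rewrite /u divzMDl ?modzMDl -?lt0n // divz_small ?modz_small ?addr0.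
have nE (n : int) : exists j : int, exists2 i : nat, (i < L)%N & n = j * L%:Z + i%:Z.
  exists (n %/ L%:Z)%Z, `|(n %% L%:Z)%Z|%N.
    by rewrite -ltz_nat gez0_abs ?modz_ge0 ?ltz_mod // -lt0n.
  by rewrite gez0_abs ?modz_ge0 -?lt0n // -divz_eq.
exists u; split=> n; have [j [i iL ->]] := nE n.
  have i0 : 0 <= i%:R / L%:R :> R by rewrite divr_ge0.
  have i1 : 0 <= 1 - i%:R / L%:R :> R.
    by rewrite subr_ge0 ler_pdivrMr // mul1r ler_nat ltnW.
  rewrite uF ?(ltnW iL) // (le_trans (rnormD _ _)) // !rnormZr !ger0_norm //.
  have -> : M * s = (1 - i%:R / L%:R) * (M * s) + i%:R / L%:R * (M * s) by ring.
  by rewrite lerD // ler_wpM2l //; [have [] := YP (j - 1)|have [] := YP j].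
have -> : j * L%:Z + i%:Z + 1 = j * L%:Z + i.+1%:Z by rewrite -addn1 PoszD addrA.
rewrite !uF ?(ltnW iL) //.
have [Y1M Y1] := YP (j - 1); have [YM Y0] := YP j.
have {}Y0 := Y0 i (ltn_addr L iL).
have {}Y1 : Y (j - 1) (L + i).+1 - T (Y (j - 1) (L + i)%N) = z (j * L%:Z + i%:Z).
  rewrite Y1 ?ltn_add2l //; congr (z _).
  by rewrite PoszD mulrBl mul1r addrA addrNK.
have -> : z (j * L%:Z + i%:Z) - (F j i.+1 - T (F j i)) =
    (L%:R^-1 : R)%:C *: (Y (j - 1) (L + i).+1 - Y j i.+1).
  rewrite /F -addnS [T _]linearD ![T _]linearZ /= addnS.
  have -> : T (Y j i) = Y j i.+1 - z (j * L%:Z + i%:Z) by rewrite -Y0 subKr.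
  have -> : T (Y (j - 1) (L + i)%N) = Y (j - 1) (L + i).+1 - z (j * L%:Z + i%:Z).
    by rewrite -Y1 subKr.
  rewrite -[in i.+1%:R]addn1 natrD mulrDl div1r !(rmorphB, rmorphD) rmorph1.
  exact: interpolation_residual.
rewrite rnormZr gtr0_norm ?invr_gt0 // ler_pdivrMl //.
apply: (le_trans (rnormB _ _)); apply: (le_trans (lerD (Y1M _) (YM _))).
rewrite /M /L !natrM.
have := ler_wpM2r (ltW s0) (ler_wpM2r (ltW kR) kC).
by move: (k%:R) => r; nra.
Qed.

End LocalSolutions.

(** * From right invertibility on the circle to shadowing *)

Section SpectrumToShadowing.
Local Open Scope complex_scope.
Context {R : realType} {X : completeNormedModType R[i]}.

Lemma int_orbit_zpow (T : {linear X -> X}) (o : int -> X) :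
  invertible_operator T -> (forall n, o (n + 1) = T (o n)) ->
  forall n, o n = zpow_op T n (o 0).
Proof.
move=> [S [_ ST TS]] oT; case=> [n|n].
  by elim: n => [//|n IH]; rewrite /= -[iter n T _]IH -oT -addn1 PoszD.
rewrite NegzE (zpow_op_inverse n.+1 ST TS).
elim: n.+1 => [|k IH]; first by rewrite oppr0.
rewrite iterS -IH -[LHS]ST /= -oT; congr (S (o _)).
by rewrite -[k.+1]addn1 PoszD opprD addrNK.
Qed.

Context (dot : {dot X for Num.conj}).

Lemma shadowing_of_right_invertible
    (norm_dot : forall x : X, `|x| ^+ 2 = dot x x) (T : {linear X -> X}) :
  bounded_operator T -> invertible_operator T ->
  (forall l : R[i], `|l| = 1 -> right_invertible_operator (l \*: idfun \- T)) ->
  shadowing_property T.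
Proof.
move=> Tb Ti rinv; have [B B0 TB] := (bounded_rnorm T).1 Tb.
have [C C0 resolvent] := uniform_resolvent Tb rinv.
have [M M0 half] := global_half_solution norm_dot C0 resolvent.
have K0 : 0 < 2 * M + 1 by rewrite ltr_wpDl // mulr_ge0.
(* The correction has size at most [2 * M * delta <= e]; the added 1 keeps the denominator positive
   when [M = 0]. *)
move=> e e0; exists (e / (2 * M + 1)); first by rewrite divr_gt0.
move=> x xT; have d0 := divr_gt0 e0 K0.
have [|||u [uM uz]] := @exact_of_half_approx _ _ int
  (fun u n => u (n + 1) - T (u n)) (1 + B) M M0 _ _ half
  (fun n => x (n + 1) - T (x n)) _ d0.
- by move=> u v i /=; rewrite linearD opprD addrACA.
- move=> u s us i; rewrite (le_trans (rnormB _ _)) // mulrDl mul1r lerD //.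
  by rewrite (le_trans (TB _)) // ler_wpM2l.
- by move=> n; rewrite -rnorm_le.
(* Since [u] solves the recurrence driven by the errors of [x], the difference [x - u] is a true
   orbit. *)
have orbit := int_orbit_zpow (o := fun n => x n - u n) Ti.
exists (x 0 - u 0) => n; rewrite -orbit => [|m].
  rewrite subKr rnorm_le (le_trans (uM n)) // mulrCA.
  by rewrite ler_piMr ?(ltW e0) // ler_pdivrMr // mul1r lerDl.
rewrite linearB -[u (m + 1)](subrK (T (u m))) uz opprD opprB addrA.
by rewrite [x _ + _]addrC subrK.
Qed.

End SpectrumToShadowing.

Theorem theorem1p7 (R : realType) (X : completeNormedModType R[i])
    (dot : {dot X for Num.conj})
    (norm_dot : forall x : X, `|x| ^+ 2 = dot x x)
    (T : {linear X -> X})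
    (T_bounded : bounded_operator T)
    (T_invertible : invertible_operator T) :
  shadowing_property T <-> right_spectrum T `&` unit_circle = set0.
Proof.
split=> [shT|/disjoints_subset spec].
  apply/seteqP; split=> // l [/= lT l1]; apply: lT.
  exact: right_invertible_of_shadowing norm_dot l T_bounded shT l1.
apply: (shadowing_of_right_invertible norm_dot T_bounded T_invertible) => l l1.
by apply: contrapT => /spec /(_ l1).
Qed.
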